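(* Let $\alpha>0$, let $g:\mathbb{N}\to\mathbb{C}$ be an arithmetic function with $g(n)=O(n^{-\alpha})$ for all $n\ge1$, and let $G(n)=\sum_{d\mid n}g(d)$ for $n\ge 1$ and $G(n)=0$ for $n\le 0$. Let $\epsilon>0$. Then, uniformly for all real $x\ge1$ and all integers $h$ with $|h|\le x/2$, $$\sum_{n\le x}\mu^2(n)\,G(n-h)=(x-H)\,K(h)+O\big(x^{\epsilon}E_1(x;\alpha)\big),$$ where $H=1$ if $h\le 0$ and $H=h$ if $h>0$, and $$K(h)=\sum_{\substack{a,b\ge1\\ \gcd(a^2,b)\mid h}}\frac{\mu(a)g(b)}{[a^2,b]}.$$ The implied constant is independent of $x$ and $h$ (it may depend on $\epsilon$, $\alpha$ and the implied constant in $g(n)=O(n^{-\alpha})$).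
   Context: $\mu$ is the Möbius function, $[\cdot,\cdot]$ the least common multiple, and the sum on the left is over positive integers $n\le x$. Every positive integer divides $0$, so for $h=0$ the condition $\gcd(a^2,b)\mid h$ is always satisfied. The error function is $$E_1(x;\alpha)=\begin{cases}x^{1-\alpha}, & 0<\alpha\le 1/2,\\ x^{1/2}, & \alpha>1/2.\end{cases}$$ *)

(* Defs.v *)
(* MathComp-Analysis: real numbers are an arbitrary [R : realType], complex
   numbers are [R[i]]. *)
From HB Require Import structures.
From mathcomp Require Import all_boot all_order all_algebra.
From mathcomp Require Import complex.
From mathcomp Require Import all_classical all_reals all_analysis.
From mathcomp.analysis.showcase Require summability.

Set Implicit Arguments.
Unset Strict Implicit.
Unset Printing Implicit Defensive.

Import Order.TTheory GRing.Theory Num.Theory.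
Import numFieldNormedType.Exports.

Local Open Scope ring_scope.
Local Open Scope complex_scope.

Definition squarefree (n : nat) : bool :=
  (0 < n)%N && all (fun p => logn p n <= 1)%N (primes n).

Definition mobius (n : nat) : int :=
  if squarefree n then (-1) ^+ size (primes n) else 0.

(* The value [g 0] is never used. *)
Definition divisor_sum (R : realType) (g : nat -> R[i]) (m : int) : R[i] :=
  if 0 < m then \sum_(d <- divisors `|m|%N) g d else 0.

Definition E1 (R : realType) (x alpha : R) : R :=
  if alpha <= 2^-1 then x `^ (1 - alpha) else x `^ 2^-1.

Definition Hshift (h : int) : int := if h <= 0 then 1 else h.

(* The summand of K(h), extended by 0 to all pairs of natural numbers. Every
   natural number divides 0 for [%|], so the gcd condition is void at h = 0. *)
Definition Kterm (R : realType) (g : nat -> R[i]) (h : int) (ab : nat * nat) :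
    R[i] :=
  let: (a, b) := ab in
  if [&& (0 < a)%N, (0 < b)%N & (gcdn (a ^ 2) b %| `|h|)%N]
  then (mobius a)%:~R * g b / (lcmn (a ^ 2) b)%:R
  else 0.

(* The double series is unordered: its partial sums are taken over finite sets
   of pairs ordered by inclusion. In R[i] such a series converges if and only if
   it converges absolutely. [R[i]^o] is R[i] with the topology of its modulus. *)
Definition Kconverges (R : realType) (g : nat -> R[i]) (h : int) : Prop :=
  cvg (summability.partial_sum (Kterm g h : _ -> R[i]^o) @ summability.totally)%classic.

(* Meaningful only when [Kconverges g h] holds. *)
Definition K (R : realType) (g : nat -> R[i]) (h : int) : R[i] :=
  @summability.sum _ R[i] R[i]^o (Kterm g h).

(* Main.v *)
Require Import Defs.
From mathcomp Require Import all_boot all_order all_algebra.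
From mathcomp Require Import complex finmap.
From mathcomp Require Import all_classical all_reals all_analysis.
From mathcomp.analysis.showcase Require summability.
From mathcomp Require Import ring lra zify.
Set Implicit Arguments.
Unset Strict Implicit.
Unset Printing Implicit Defensive.
Import Order.TTheory GRing.Theory Num.Theory.
Import numFieldNormedType.Exports.
Local Open Scope ring_scope.
Local Open Scope complex_scope.

(** Since mu^2(n) is the sum of mu(a) over the a with a^2 | n, the left-hand
    side is the sum over pairs (a, b) of mu(a) g(b) times the number of n with
    max(h, 0) < n <= x, a^2 | n and b | n - h. Put m = [a^2, b]. By the Chinese
    remainder theorem such n form one residue class modulo m if gcd(a^2, b)
    divides h, and do not exist otherwise. So the number is (x - H)/m + O(1) in
    the first case and 0 in the second, and the terms (x - H)/m add up to
    (x - H) K(h). What has to be shown is that the errors are small in total.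

    Let beta = min(alpha, 1/2). Then E_1(x; alpha) = x^(1 - beta) and
    g(b) = O(b^(-beta)), so the two ranges of alpha become one. Fix a small
    d > 0 and let s = 1 - beta + d, with 1/2 < s <= 1.
    - If m <= x, the error O(1) is O((x/m)^s).
    - If m > x, the main term (x - H)/m is at most x/m <= (x/m)^s.
    These two errors are therefore at most x^s times the sum of
    b^(-beta) m^(-s) over all pairs. That sum converges
    ([sum_pair_weight_le]): writing b = gcd(a^2, b) c gives m = a^2 c, and the
    number of possible gcds is bounded by the number of divisors of a^2, hence
    by O(a^d) ([divisor_bound]); what remains are the sums of c^(-1-d) and
    a^(-1-d). The same convergent sum dominates K(h).
    - If m > x, there remains the number of n itself ([tail_count_le]). Here
    b >= m/a^2 > x/a^2, so b^(-beta) is at most (a^2/x)^beta, and for given n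
    the number of b is at most the number of divisors of n - h, which is
    O(x^d). At most x/a^2 integers n <= x are multiples of a^2, and none if
    a^2 > x, so their number is at most (x/a^2)^(1+d). The total is O(x^d) times
    the sum over a of (x/a^2)^s, which is O(x^(s+d)).

    All these bounds concern finite boxes a, b <= N and are uniform in N. Since
    K(h) is a limit over finite sets of pairs, it is approximated by the sum
    over a large enough box. *)

(** * Unordered summability of complex families *)

Lemma ler_sum_fsubset (R : numDomainType) (I : choiceType) (u : I -> R)
    (A B : {fset I}) :
  (forall i, 0 <= u i) -> (A `<=` B)%fset ->
  \sum_(i <- A) u i <= \sum_(i <- B) u i.
Proof.
move=> u0 AB; rewrite [leRHS](big_fsetID _ (mem A)) /=.
have -> : [fset x in B | x \in A]%fset = A.
  apply/fsetP => x; rewrite !inE andbC; apply: andb_idr; exact: (fsubsetP AB).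
by rewrite lerDl; apply: sumr_ge0.
Qed.

(** The limit is the supremum of the finite sums. *)
Lemma bounded_nonneg_series_cvg (R : realType) (I : choiceType) (u : I -> R)
    (M : R) :
  (forall i, 0 <= u i) -> (forall J : {fset I}, \sum_(i <- J) u i <= M) ->
  exists l : R, forall e : R, 0 < e -> exists J0 : {fset I},
    forall J : {fset I}, (J0 `<=` J)%fset -> `|l - \sum_(i <- J) u i| < e.
Proof.
move=> u0 uM; pose E := [set \sum_(i <- J) u i | J in [set: {fset I}]]%classic.
have ubE : ubound E M by move=> _ [J _ <-].
have hE : has_sup E.
  by split; [exists (\sum_(i <- fset0) u i), fset0 | exists M].
exists (sup E) => e e0.
have [_ [J0 _ <-] ltJ0] := sup_adherent e0 hE.
exists J0 => J J0J; have leJ := ler_sum_fsubset u0 J0J.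
have : \sum_(i <- J) u i <= sup E by apply: ub_le_sup; [exists M | exists J].
rewrite ltr_norml; lra.
Qed.

(** The series is the difference of the nonnegative series of [`|u i| + u i]
    and [`|u i|]. *)
Lemma bounded_real_series_cvg (R : realType) (I : choiceType) (u : I -> R)
    (M : R) :
  (forall J : {fset I}, \sum_(i <- J) `|u i| <= M) ->
  exists l : R, forall e : R, 0 < e -> exists J0 : {fset I},
    forall J : {fset I}, (J0 `<=` J)%fset -> `|l - \sum_(i <- J) u i| < e.
Proof.
move=> uM.
have [l1 Hl1] := @bounded_nonneg_series_cvg _ _ (fun i => `|u i|) M
  (fun i => normr_ge0 _) uM.
have [|J|l2 Hl2] := @bounded_nonneg_series_cvg _ _ (fun i => `|u i| + u i) (M + M).
- by move=> i; have := ler_norm (- u i); rewrite normrN; lra.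
- rewrite big_split /=; apply: lerD => //; apply: le_trans (uM J).
  by apply: ler_sum => i _; exact: ler_norm.
exists (l2 - l1) => e e0; have e20 : 0 < e / 2 by rewrite divr_gt0.
have [J1 HJ1] := Hl1 _ e20; have [J2 HJ2] := Hl2 _ e20.
exists (J1 `|` J2)%fset => J; rewrite fsubUset => /andP[/HJ1 h1 /HJ2].
move: h1; rewrite big_split /= !ltr_norml; lra.
Qed.

Lemma normc_le_ReIm (R : rcfType) (z : R[i]) :
  `|z| <= (`|complex.Re z| + `|complex.Im z|)%:C.
Proof.
case: z => a b; rewrite normc_def lecR /=.
rewrite -(ger0_norm (addr_ge0 (normr_ge0 a) (normr_ge0 b))) -sqrtr_sqr.
rewrite ler_wsqrtr // sqrrD !real_normK ?num_real // lerD2r lerDl.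
by rewrite mulrn_wge0 // mulr_ge0.
Qed.

Lemma norm_Re_le (R : rcfType) (z : R[i]) : (`|complex.Re z|)%:C <= `|z|.
Proof.
case: z => a b; rewrite normc_def lecR /= -sqrtr_sqr ler_wsqrtr // lerDl.
exact: sqr_ge0.
Qed.

Lemma norm_Im_le (R : rcfType) (z : R[i]) : (`|complex.Im z|)%:C <= `|z|.
Proof.
case: z => a b; rewrite normc_def lecR /= -sqrtr_sqr ler_wsqrtr // lerDr.
exact: sqr_ge0.
Qed.

(** The sums of the absolute values of the real and of the imaginary parts are
    bounded too, so the two parts converge separately. *)
Lemma bounded_complex_series_cvg (R : realType) (I : choiceType)
    (f : I -> R[i]) (M : R) :
  (forall J : {fset I}, \sum_(i <- J) `|f i| <= M%:C) ->
  cvg (summability.partial_sum (f : I -> R[i]^o) @ summability.totally)%classic.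
Proof.
move=> fM.
have [|l1 Hl1] := @bounded_real_series_cvg R I (fun i => complex.Re (f i)) M.
  move=> J; rewrite -lecR; apply: le_trans (fM J); rewrite rmorph_sum /=.
  by apply: ler_sum => i _; exact: norm_Re_le.
have [|l2 Hl2] := @bounded_real_series_cvg R I (fun i => complex.Im (f i)) M.
  move=> J; rewrite -lecR; apply: le_trans (fM J); rewrite rmorph_sum /=.
  by apply: ler_sum => i _; exact: norm_Im_le.
have FF := @summability.totally_filter I.
apply/cvg_ex; exists (l1 +i* l2 : R[i]^o).
apply/(@cvgrPdist_lt R[i] R[i]^o) => e e0.
have eE : e = (complex.Re e)%:C.
  by case: e e0 => a b; rewrite ltcE /= => /andP[/eqP->].
have e1 : 0 < complex.Re e by rewrite -ltcR -eE.
have e20 : 0 < complex.Re e / 2 by rewrite divr_gt0.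
have [J1 HJ1] := Hl1 _ e20; have [J2 HJ2] := Hl2 _ e20.
exists (J1 `|` J2)%fset => // J /=; rewrite fsubUset => /andP[/HJ1 h1 /HJ2 h2].
pose z : R[i] := (l1 +i* l2) - \sum_(i <- J) f i.
suff : `|z| < e by rewrite /summability.partial_sum -(big_seq_fsetE _ J xpredT).
apply: le_lt_trans (normc_le_ReIm z) _.
rewrite eE ltcR /z !raddfB /= !raddf_sum /= !sumrN.
by rewrite [ltRHS]splitr ltrD.
Qed.

(** * Moebius function and squares *)

Lemma squarefreePn n : (0 < n)%N -> ~~ squarefree n ->
  exists2 p, prime p & (p ^ 2 %| n)%N.
Proof.
move=> n0; rewrite /squarefree n0 /= => /allPn[p].
rewrite mem_primes => /and3P[pp _ _]; rewrite -ltnNge => lp.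
by exists p => //; rewrite pfactor_dvdn.
Qed.

Lemma squarefree_dvdn_sqr a n : squarefree n -> (a ^ 2 %| n)%N -> a = 1%N.
Proof.
move=> /andP[n0 /allP sf] an.
have a0 : (0 < a)%N by case: a an => //; rewrite exp0n // dvd0n; lia.
apply/eqP; rewrite eqn_leq a0 andbT leqNgt; apply/negP => a1.
have pp := pdiv_prime a1; have := dvdn_trans (dvdn_exp2r 2 (pdiv_dvd a)) an.
move: (pdiv a) pp => p pp pn.
have /sf : p \in primes n.
  by rewrite mem_primes pp n0 (dvdn_trans _ pn) // dvdn_exp.
by move: pn; rewrite pfactor_dvdn // => /leq_trans h /h.
Qed.

Lemma perm_primes_primeM p a : prime p -> (0 < a)%N -> ~~ (p %| a)%N ->
  perm_eq (primes (p * a)) (p :: primes a).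
Proof.
move=> pp a0 pa; have p0 := prime_gt0 pp; apply: uniq_perm => [||q].
- exact: primes_uniq.
- by rewrite /= primes_uniq mem_primes (negbTE pa) !andbF.
- by rewrite primesM // primes_prime // !inE.
Qed.

Lemma squarefree_primeM p a : prime p -> (0 < a)%N -> ~~ (p %| a)%N ->
  squarefree (p * a) = squarefree a.
Proof.
move=> pp a0 pa; have p0 := prime_gt0 pp.
rewrite /squarefree muln_gt0 p0 a0 /= (perm_all _ (perm_primes_primeM pp a0 pa)) /=.
rewrite lognM // (lognE p a) (negbTE pa) !andbF logn_prime // eqxx /=.
apply: eq_in_all => q; rewrite mem_primes => /and3P[pq _ qa].
rewrite lognM // logn_prime //.
by case: eqP => // pq_eq; rewrite -pq_eq qa in pa.
Qed.

Lemma mobius_primeM p a : prime p -> (0 < a)%N -> ~~ (p %| a)%N ->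
  mobius (p * a) = - mobius a.
Proof.
move=> pp a0 pa; rewrite /mobius squarefree_primeM //.
rewrite (perm_size (perm_primes_primeM pp a0 pa)) /= exprS mulN1r.
by case: ifP; rewrite ?oppr0.
Qed.

(** If p^2 | n with p prime, exchanging a and p a pairs the squarefree a with
    a^2 | n so that the Moebius values in a pair cancel. *)
Lemma sum_mobius_sqr_dvdn n N : (0 < n <= N)%N ->
  \sum_(1 <= a < N.+1 | (a ^ 2 %| n)%N) mobius a = mobius n ^+ 2.
Proof.
move=> /andP[n0 nN].
have [sf|nsf] := boolP (squarefree n).
  have -> : mobius n ^+ 2 = 1.
    by rewrite /mobius sf -exprM mulnC exprM sqrrN !expr1n.
  rewrite big_ltn_cond; last lia.
  rewrite exp1n dvd1n big_nat_cond big1 ?addr0 // => a.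
  by move=> /andP[/andP[a1 _] /(squarefree_dvdn_sqr sf) a_1]; rewrite a_1 in a1.
have [p pp pn] := squarefreePn n0 nsf; have p0 := prime_gt0 pp.
rewrite {2}/mobius (negbTE nsf) expr0n /=.
pose s := [seq a <- index_iota 1 N.+1 | squarefree a && (a ^ 2 %| n)%N].
have -> : \sum_(1 <= a < N.+1 | (a ^ 2 %| n)%N) mobius a = \sum_(a <- s) mobius a.
  rewrite big_filter [RHS]big_mkcond [LHS]big_mkcond /=; apply: eq_bigr => a _.
  have [//|/negbTE nsfa /=] := boolP (squarefree a).
  by rewrite /mobius nsfa if_same.
pose t a := (if p %| a then a %/ p else p * a)%N.
have memsE a : (a \in s) = squarefree a && (a ^ 2 %| n)%N.
  rewrite mem_filter mem_index_iota andb_idr // => /andP[/andP[a0 _] an].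
  rewrite a0 ltnS (leq_trans _ nN) // dvdn_leq //.
  by apply: dvdn_trans an; rewrite dvdn_exp.
have ts a : a \in s -> [/\ t a \in s, t (t a) = a & mobius (t a) = - mobius a].
  rewrite !memsE => /andP[sfa an]; have /andP[a0 _] := sfa.
  rewrite /t; case: ifPn => [/dvdnP[c aE]|pa].
    rewrite mulnC in aE; rewrite aE mulKn //.
    have c0 : (0 < c)%N by move: a0; rewrite aE muln_gt0 => /andP[].
    have pc : ~~ (p %| c)%N.
      apply/negP => /dvdnP[d cE].
      have /(squarefree_dvdn_sqr sfa) p1 : (p ^ 2 %| a)%N.
        by rewrite aE cE -mulnn mulnCA dvdn_mull.
      by rewrite p1 in pp.
    rewrite (negbTE pc) -(squarefree_primeM pp) // -aE sfa /=; split => //.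
    - by apply: dvdn_trans an; rewrite dvdn_exp2r // aE dvdn_mull.
    - by rewrite aE mobius_primeM // opprK.
  rewrite dvdn_mulr // mulKn // squarefree_primeM // sfa mobius_primeM //.
  split => //; rewrite expnMn Gauss_dvd ?pn ?an //.
  by rewrite coprimeXl // coprimeXr // prime_coprime.
have perm_ts : perm_eq (map t s) s.
  have us : uniq s by rewrite filter_uniq // iota_uniq.
  have uts : uniq (map t s).
    rewrite map_inj_in_uniq // => a b /ts[_ ta _] /ts[_ tb _] tab.
    by rewrite -ta tab tb.
  have sub : {subset map t s <= s} by move=> _ /mapP[a /ts[tas _ _] ->].
  by apply: uniq_perm => //; case: (uniq_min_size uts sub); rewrite ?size_map.
have : \sum_(a <- s) mobius a = - \sum_(a <- s) mobius a.
  rewrite -{1}(perm_big _ perm_ts) big_map /= -sumrN.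
  by rewrite !big_seq; apply: eq_bigr => a /ts[].
lia.
Qed.

(** * Counting simultaneous divisibility *)

(** The number of multiples of m in an interval, as a difference of two floors;
    the shift t lets it count any residue class. *)
Lemma sum_dvdn_shift m t L X : (0 < m)%N -> (L <= X)%N ->
  (\sum_(L.+1 <= n < X.+1) (m %| n + t) + (L + t) %/ m = (X + t) %/ m)%N.
Proof.
move=> m0; elim: X => [|X IH]; first by rewrite leqn0 => /eqP->; rewrite big_geq.
rewrite leq_eqVlt => /predU1P[->|LX]; first by rewrite big_geq.
rewrite big_nat_recr //= addSn divnS // -IH //; lia.
Qed.

(** The two congruences have a common solution n0 by Bezout, and n solves both
    exactly when lcm(q, b) divides n - n0. The shift t is the residue of - n0,
    so that only natural numbers occur. *)
Lemma dvdz_congruence_pair (q b : nat) (h : int) : (0 < q)%N -> (0 < b)%N ->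
  (gcdn q b %| `|h|)%N ->
  exists t : nat, forall n : nat,
    (q %| n)%N && (b %| `|n%:Z - h|)%N = (lcmn q b %| n + t)%N.
Proof.
move=> q0 b0 gh; have m_gt0 : (0 < lcmn q b)%N by rewrite lcmn_gt0 q0.
have [u [v uv]] := Bezoutz q b.
have /dvdzP[k hE] : (gcdz q b %| h)%Z by rewrite dvdzE.
pose n0 : int := u * q%:Z * k; pose m := lcmn q b.
exists `|((- n0) %% m%:Z)%Z|%N => n.
have m_neq0 : m%:Z != 0 by rewrite -lt0n.
have qn0 : (q%:Z %| n0)%Z by rewrite /n0 mulrAC dvdz_mull.
have bn0 : (b%:Z %| h - n0)%Z.
  have -> : h - n0 = (v * k) * b%:Z by rewrite hE -uv /n0; ring.
  exact: dvdz_mull.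
have tE : `|((- n0) %% m%:Z)%Z|%N%:Z = - n0 - ((- n0) %/ m%:Z)%Z * m%:Z.
  by rewrite gez0_abs ?modz_ge0 // /modz.
have -> : (m %| n + `|((- n0) %% m%:Z)%Z|)%N = (m %| `|n%:Z - n0|)%N.
  have -> : (m %| n + `|((- n0) %% m%:Z)%Z|)%N =
            (m%:Z %| n%:Z + `|((- n0) %% m%:Z)%Z|%N%:Z)%Z by rewrite dvdzE -PoszD.
  rewrite tE addrA rpredBr ?dvdzE // -dvdzE; exact: dvdz_mull.
rewrite dvdn_lcm; congr andb.
- have -> : (q %| n)%N = (q%:Z %| n%:Z)%Z by [].
  by rewrite -[RHS]/(q%:Z %| n%:Z - n0)%Z rpredBr.
- rewrite -[LHS]/(b%:Z %| n%:Z - h)%Z -[RHS]/(b%:Z %| n%:Z - n0)%Z.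
  have -> : n%:Z - n0 = (n%:Z - h) + (h - n0) by rewrite addrA subrK.
  by rewrite [RHS]rpredDr.
Qed.

Definition pair_count (q b : nat) (h : int) (L X : nat) : nat :=
  \sum_(L.+1 <= n < X.+1) ((q %| n) && (b %| `|n%:Z - h|))%N.

(** The remainders of the two floors in [sum_dvdn_shift] differ by less than the
    modulus. When gcd(q, b) does not divide h there is nothing to count. *)
Lemma pair_count_approx (R : realType) (q b : nat) (h : int) (L X : nat) :
  (0 < q)%N -> (0 < b)%N -> (L <= X)%N ->
  `| (pair_count q b h L X)%:R
     - (if (gcdn q b %| `|h|)%N then (X - L)%:R / (lcmn q b)%:R else 0)| <= 1 :> R.
Proof.
move=> q0 b0 LX; have m0 : (0 < lcmn q b)%N by rewrite lcmn_gt0 q0.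
case: ifPn => gh; last first.
  rewrite /pair_count big1 ?subr0 ?normr0 // => n _.
  case: andP => // -[qn bn]; case/negP: gh.
  have -> : (gcdn q b %| `|h|)%N = ((gcdn q b)%:Z %| n%:Z - (n%:Z - h))%Z.
    by rewrite opprB addrC subrK.
  apply: rpredB; rewrite dvdzE.
  - exact: dvdn_trans (dvdn_gcdl _ _) qn.
  - exact: dvdn_trans (dvdn_gcdr _ _) bn.
have [t ht] := dvdz_congruence_pair q0 b0 gh.
have := sum_dvdn_shift t m0 LX.
rewrite -(eq_bigr _ (fun n _ => congr1 nat_of_bool (ht n))).
rewrite -/(pair_count q b h L X); set m := lcmn q b.
set c := pair_count _ _ _ _ _ => cE.
have mR : 0 < m%:R :> R by rewrite ltr0n.
have XE := divn_eq (X + t) m; have LE := divn_eq (L + t) m.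
have := ltn_pmod (X + t) m0; have := ltn_pmod (L + t) m0; rewrite -/m.
move: XE LE cE; set XQ := ((X + t) %/ m)%N; set LQ := ((L + t) %/ m)%N.
move: ((X + t) %% m)%N ((L + t) %% m)%N => r1 r2 XE LE cE r2m r1m.
have cmE : (c * m + r1 = (X - L) + r2)%N.
  by move: XE; rewrite -cE mulnDl; lia.
have cmR : c%:R * m%:R = (X - L)%:R + r2%:R - r1%:R :> R.
  by rewrite -natrM -natrD -cmE natrD addrK.
have -> : c%:R - (X - L)%:R / m%:R = (r2%:R - r1%:R) / m%:R :> R.
  rewrite -[c%:R](mulfK (lt0r_neq0 mR)) cmR; field; exact: lt0r_neq0.
rewrite normrM normfV (gtr0_norm mR) ler_pdivrMr // mul1r ler_norml.
have r1R : r1%:R <= m%:R :> R by rewrite ler_nat ltnW.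
have r2R : r2%:R <= m%:R :> R by rewrite ler_nat ltnW.
have := ler0n R r1; have := ler0n R r2; lra.
Qed.

(** * Sums of powers and the divisor bound *)

(** A divisor d of m n is the product of gcd(d, m), which divides m, and of its
    cofactor, which divides n; so d is determined by a pair of divisors. *)
Lemma size_divisorsM m n : (0 < m)%N -> (0 < n)%N ->
  (size (divisors (m * n)) <= size (divisors m) * size (divisors n))%N.
Proof.
move=> m0 n0; rewrite -(size_allpairs muln).
apply: uniq_leq_size => [|d]; first exact: divisors_uniq.
rewrite -dvdn_divisors ?muln_gt0 ?m0 // => dmn; apply/allpairsP.
have g0 : (0 < gcdn d m)%N by rewrite gcdn_gt0 m0 orbT.
exists (gcdn d m, d %/ gcdn d m)%N; split => /=.
- by rewrite -dvdn_divisors // dvdn_gcdr.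
- rewrite -dvdn_divisors //.
  have cop : coprime (d %/ gcdn d m) (m %/ gcdn d m).
    rewrite /coprime -(eqn_pmul2r g0) muln_gcdl !divnK ?dvdn_gcdl ?dvdn_gcdr //.
    by rewrite mul1n.
  rewrite -(Gauss_dvdr _ cop) -(dvdn_pmul2r g0) mulnAC.
  by rewrite !divnK ?dvdn_gcdl ?dvdn_gcdr.
- by rewrite mulnC divnK // dvdn_gcdl.
Qed.

Lemma size_divisors_pfactor p k : prime p -> (size (divisors (p ^ k)) <= k.+1)%N.
Proof.
move=> pp; rewrite -[leqRHS](size_iota 0) -(size_map (expn p) (iota _ _)).
apply: uniq_leq_size => [|d]; first exact: divisors_uniq.
rewrite -dvdn_divisors ?expn_gt0 ?prime_gt0 // => /(dvdn_pfactor _ _ pp)[i ik ->].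
by apply: map_f; rewrite mem_iota.
Qed.

(** A discrete form of the mean value theorem: the ratio of n^(-d) to (n+1)^(-d)
    is exp(- d ln(1 - 1/(n+1))), at least 1 + d/(n+1). It makes the sum of
    n^(-1-d) telescope. *)
Lemma powR_pred_sub (R : realType) (d : R) (n : nat) : 0 < d -> (0 < n)%N ->
  d * n.+1%:R `^ (- 1 - d) <= n%:R `^ (- d) - n.+1%:R `^ (- d).
Proof.
move=> d0 n0; have n0R : 0 < n%:R :> R by rewrite ltr0n.
have n1R : 0 < n.+1%:R :> R by rewrite ltr0n.
have -> : n%:R `^ (- d) = n.+1%:R `^ (- d) * expR (- d * ln (1 - n.+1%:R^-1)).
  rewrite /powR !gt_eqF // -expRD -mulrDr -lnM ?posrE //; last first.
    by rewrite subr_gt0 invf_lt1 // ltr1n ltnS.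
  by congr (expR (_ * ln _)); rewrite mulrBr mulr1 mulfV ?gt_eqF // -natr1 addrK.
have -> : n.+1%:R `^ (- 1 - d) = n.+1%:R `^ (- d) * n.+1%:R^-1 :> R.
  rewrite addrC powRD; last by rewrite pnatr_eq0 implybT.
  by rewrite powR_inv1.
rewrite mulrCA -[X in _ <= _ - X]mulr1 -mulrBr ler_pM2l ?powR_gt0 //.
apply: le_trans (lerB (expR_ge1Dx _) (lexx 1)).
rewrite [1 + _]addrC addrK mulNr -mulrN ler_pM2l // lerNr; apply: le_ln1Dx.
by rewrite ltrN2 invf_lt1 // ltr1n ltnS.
Qed.

Lemma sum_powR_le (R : realType) (d : R) (N : nat) : 0 < d ->
  \sum_(1 <= n < N.+1) n%:R `^ (- 1 - d) <= 1 + d^-1.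
Proof.
move=> d0.
suff : \sum_(1 <= n < N.+2) n%:R `^ (- 1 - d) <= 1 + d^-1 * (1 - N.+1%:R `^ (- d)).
  rewrite big_nat_recr //= mulrBr mulr1 => h.
  have h1 : 0 <= N.+1%:R `^ (- 1 - d) :> R by exact: powR_ge0.
  have h2 : 0 <= d^-1 * N.+1%:R `^ (- d).
    by rewrite mulr_ge0 ?powR_ge0 // invr_ge0 ltW.
  by move: h h1 h2; lra.
elim: N => [|N IH]; first by rewrite big_nat1 !powR1 subrr mulr0 addr0.
rewrite big_nat_recr //=; have := powR_pred_sub d0 (ltn0Sn N).
rewrite -ler_pdivlMl // => h; apply: le_trans (lerD IH h) _.
rewrite -addrA -mulrDr lerD2l ler_pM2l ?invr_gt0 //; lra.
Qed.

(** From 1 + t <= exp(t) with t = k d ln 2. *)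
Lemma succ_le_powR2 (R : realType) (d : R) : 0 < d ->
  forall k : nat, k.+1%:R <= (1 + (d * ln 2)^-1) * (2 `^ d) ^+ k.
Proof.
move=> d0 k; have l2 : 0 < ln 2 :> R by rewrite ln_gt0 // ltr1n.
have dl : 0 < d * ln 2 by rewrite mulr_gt0.
have -> : (2 `^ d) ^+ k = expR (d * ln 2 * k%:R).
  by rewrite /powR pnatr_eq0 /= expRM_natr.
have := expR_ge1Dx (d * ln 2 * k%:R); set e := expR _ => he.
rewrite mulrDl mul1r -natr1 addrC; apply: lerD.
  by apply: le_trans he; rewrite lerDl !mulr_ge0 // ltW.
rewrite ler_pdivlMl //; apply: le_trans he; rewrite lerDr.
exact: ler01.
Qed.

(** At a prime p the exponent k contributes k + 1 to the number of divisors and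
    p^(d k) to n^d. If p >= 2^(1/d), then p^(d k) >= 2^k >= k + 1; each of the
    finitely many smaller primes costs at most a factor M. *)
Lemma divisor_bound (R : realType) (d : R) : 0 < d ->
  exists C : R, forall n : nat, (0 < n)%N ->
    (size (divisors n))%:R <= C * n%:R `^ d.
Proof.
move=> d0; pose M : R := 1 + (d * ln 2)^-1.
have M1 : 1 <= M.
  by rewrite lerDl invr_ge0 mulr_ge0 ?ln_ge0 ?ler1n // ltW.
pose P := (Num.truncn (2 `^ d^-1 : R)).+1.
have primeP p k : prime p ->
    k.+1%:R <= (if (p < P)%N then M else 1) * (p ^ k)%:R `^ d.
  move=> pp; have -> : (p ^ k)%:R `^ d = (p%:R `^ d) ^+ k.
    by rewrite natrX -powR_mulrn ?ler0n // powRAC powR_mulrn ?powR_ge0.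
  case: ltnP => [_|Pp].
    apply: le_trans (succ_le_powR2 d0 k) _.
    rewrite ler_pM2l ?(lt_le_trans ltr01) //.
    rewrite lerXn2r ?nnegrE ?powR_ge0 //.
    rewrite ge0_ler_powR ?nnegrE ?ler0n ?(ltW d0) //.
    by rewrite ler_nat prime_gt1.
  rewrite mul1r; apply: (@le_trans _ _ (2 ^+ k)).
    by have := ltn_expl k (isT : (1 < 2)%N); rewrite -(ler_nat R) natrX.
  rewrite lerXn2r ?nnegrE ?powR_ge0 //.
  have -> : 2 = (2 `^ d^-1) `^ d :> R by rewrite -powRrM mulVf ?gt_eqF // powRr1.
  rewrite ge0_ler_powR ?nnegrE ?powR_ge0 ?ler0n ?(ltW d0) //.
  by apply: le_trans (ltW (truncnS_gt _)) _; rewrite ler_nat.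
exists (M ^+ P).
(* Induction on a strict bound k for the prime factors of n, which costs M for
   each of the numbers below both k and P. *)
have key k : forall n, (0 < n)%N ->
    (forall p, prime p -> (p %| n)%N -> (p < k)%N) ->
    (size (divisors n))%:R <= M ^+ (minn k P) * n%:R `^ d.
  elim: k => [|k IH] n n0 Hn.
    have -> : n = 1%N.
      apply/eqP; rewrite eqn_leq n0 andbT leqNgt; apply/negP => n1.
      by have := Hn _ (pdiv_prime n1) (pdiv_dvd n).
    by rewrite min0n powR1 mulr1.
  have Mk : M ^+ minn k P <= M ^+ minn k.+1 P by apply: ler_weXn2l => //; lia.
  have [pk|npk] := boolP (prime k); last first.
    apply: le_trans (IH n n0 _) _.
      move=> p pp pn; have := Hn p pp pn; rewrite ltnS leq_eqVlt => /predU1P[pE|//].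
      by rewrite -pE pp in npk.
    by rewrite ler_wpM2r ?powR_ge0.
  have [m0 pm] : (0 < n`_k^')%N /\
      forall p, prime p -> (p %| n`_k^')%N -> (p < k)%N.
    split=> [|p pp pm]; first exact: part_gt0.
    have := Hn p pp (dvdn_trans pm (dvdn_part _ _)).
    rewrite ltnS leq_eqVlt => /predU1P[pE|//].
    have := pnat_dvd pm (part_pnat _ _); rewrite pE.
    by rewrite pnatE // !inE eqxx.
  rewrite -{1 2}(partnC k n0) p_part natrM powRM ?ler0n //.
  apply: (@le_trans _ _ ((logn k n).+1%:R * (size (divisors n`_k^'))%:R)).
    rewrite -natrM ler_nat; apply: leq_trans (size_divisorsM _ m0) _.
      by rewrite expn_gt0 prime_gt0.
    by rewrite leq_mul // size_divisors_pfactor.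
  have h2 := IH _ m0 pm.
  apply: le_trans (ler_pM _ _ (primeP _ (logn k n) pk) h2) _; rewrite ?ler0n //.
  rewrite mulrACA ler_wpM2r ?mulr_ge0 ?powR_ge0 //.
  case: ifPn => kP; last by rewrite mul1r.
  by rewrite -exprS ler_weXn2l //; lia.
move=> n n0; apply: le_trans (key n.+1 n n0 _) _.
  by move=> p pp pn; rewrite ltnS dvdn_leq.
by rewrite ler_wpM2r ?powR_ge0 // ler_weXn2l // geq_minr.
Qed.

(** * The error terms *)

Lemma lcmn_gcd_quot q b : lcmn q b = (q * (b %/ gcdn q b))%N.
Proof. by rewrite /lcmn muln_divA // dvdn_gcdr. Qed.

Lemma gcd_quot_gt0 q b : (0 < b)%N -> (0 < b %/ gcdn q b)%N.
Proof.
move=> b0; rewrite divn_gt0 ?gcdn_gt0 ?b0 ?orbT //.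
by rewrite dvdn_leq // dvdn_gcdr.
Qed.

(** Every b is g c with g = gcd(q, b) a divisor of q and c the argument of f, so
    each value f c is taken at most once for each divisor g. *)
Lemma sum_gcd_quot_le (R : realType) (f : nat -> R) (q N : nat) :
  (0 < q)%N -> (forall c, 0 <= f c) ->
  \sum_(1 <= b < N.+1) f (b %/ gcdn q b)%N
    <= (size (divisors q))%:R * \sum_(1 <= c < N.+1) f c.
Proof.
move=> q0 f0.
apply: (@le_trans _ _ (\sum_(1 <= b < N.+1) \sum_(g <- divisors q)
    \sum_(1 <= c < N.+1) (b == g * c)%N%:R * f c)).
  rewrite big_nat [leRHS]big_nat; apply: ler_sum => b /andP[b0 bN].
  have gq : gcdn q b \in divisors q by rewrite -dvdn_divisors // dvdn_gcdl.
  rewrite (big_rem _ gq) /=.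
  have cN : (b %/ gcdn q b)%N \in index_iota 1 N.+1.
    rewrite mem_index_iota gcd_quot_gt0 //=.
    by apply: leq_ltn_trans bN; exact: leq_div.
  rewrite (big_rem _ cN) /= mulnC divnK ?dvdn_gcdr // eqxx mul1r -addrA lerDl.
  by rewrite addr_ge0 // !sumr_ge0 // => *; rewrite ?sumr_ge0 // => *; rewrite mulr_ge0.
rewrite exchange_big /= -sum1_size natr_sum mulr_suml; apply: ler_sum => g _.
rewrite exchange_big /= mul1r; apply: ler_sum => c _; rewrite -mulr_suml.
rewrite ler_piMl // -natr_sum lern1.
rewrite (_ : (\sum_(_ <= b < _) _)%N = count_mem (g * c)%N (index_iota 1 N.+1)).
  by rewrite count_uniq_mem ?iota_uniq // leq_b1.
by rewrite -sum1_count [RHS]big_mkcond; apply: eq_bigr => b _ /=; case: eqP.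
Qed.

Lemma powRN_le (R : realType) (x y r : R) : 0 < x -> x <= y -> 0 <= r ->
  y `^ (- r) <= x `^ (- r).
Proof.
move=> x0 xy r0; have y0 := lt_le_trans x0 xy.
rewrite !powRN lef_pV2 ?posrE ?powR_gt0 //.
by apply: ge0_ler_powR => //; rewrite nnegrE ltW.
Qed.

Lemma powR_sqr_natr (R : realType) (a : nat) (r : R) :
  (a ^ 2)%:R `^ r = a%:R `^ (2 * r).
Proof. by rewrite natrX -powR_mulrn ?ler0n // -powRrM. Qed.

(** The exponent of a is - 2 (1 - beta + d) <= - 1 - d. *)
Lemma sum_sqr_powR_le (R : realType) (beta d : R) (N : nat) :
  beta <= 2^-1 -> 0 < d ->
  \sum_(1 <= a < N.+1) (a ^ 2)%:R `^ (- (1 - beta + d)) <= 1 + d^-1.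
Proof.
move=> b2 d0; apply: le_trans (sum_powR_le N d0).
rewrite big_nat [leRHS]big_nat; apply: ler_sum => a /andP[a1 _].
by rewrite powR_sqr_natr ler_powR ?ler1n //; lra.
Qed.

(** With s = 1 - beta + d, the common majorant of the terms of K(h) and of the
    counting errors. *)
Definition pair_weight (R : realType) (beta s : R) (a b : nat) : R :=
  b%:R `^ (- beta) * (lcmn (a ^ 2) b)%:R `^ (- s).

(** For fixed a, put b = gcd(a^2, b) c. Then [a^2, b] = a^2 c and b >= c, so the
    weight is at most a^(-2 s) c^(-beta-s), where - beta - s = - 1 - d. Each c
    comes from O(a^d) values of b, and - 2 s + d <= - 1 - d. *)
Lemma sum_pair_weight_le (R : realType) (beta d : R) :
  0 <= beta -> beta <= 2^-1 -> 0 < d ->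
  exists C : R, forall N : nat,
    \sum_(1 <= a < N.+1) \sum_(1 <= b < N.+1)
      pair_weight beta (1 - beta + d) a b <= C.
Proof.
move=> b0 b2 d0; have d20 : 0 < d / 2 by rewrite divr_gt0.
have [D HD] := divisor_bound d20; pose Z : R := 1 + d^-1.
have D0 : 0 <= D.
  by have := HD 1%N isT; rewrite powR1 mulr1 => /(le_trans (ler0n _ _)).
have Z0 : 0 <= Z by rewrite addr_ge0 // invr_ge0 ltW.
exists (D * Z * Z) => N.
apply: (@le_trans _ _ (\sum_(1 <= a < N.+1) D * Z * a%:R `^ (- 1 - d))); last first.
  by rewrite -mulr_sumr ler_wpM2l ?mulr_ge0 // sum_powR_le.
rewrite big_nat [leRHS]big_nat; apply: ler_sum => a /andP[a1 _].
have q0 : (0 < a ^ 2)%N by rewrite expn_gt0 a1.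
apply: (@le_trans _ _ ((a ^ 2)%:R `^ (- (1 - beta + d)) *
    \sum_(1 <= b < N.+1) (b %/ gcdn (a ^ 2) b)%:R `^ (- 1 - d))).
  rewrite mulr_sumr big_nat [leRHS]big_nat; apply: ler_sum => b /andP[b1 _].
  rewrite /pair_weight lcmn_gcd_quot natrM powRM ?ler0n // mulrCA.
  rewrite ler_wpM2l ?powR_ge0 //; set c := (b %/ _)%N.
  have c0 : (0 < c)%N by exact: gcd_quot_gt0.
  have -> : - 1 - d = - beta + - (1 - beta + d) by lra.
  rewrite powRD; last by rewrite pnatr_eq0 -lt0n c0 implybT.
  by rewrite ler_wpM2r ?powR_ge0 // powRN_le ?ltr0n // ler_nat leq_div.
apply: (@le_trans _ _ ((a ^ 2)%:R `^ (- (1 - beta + d)) *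
    (D * (a ^ 2)%:R `^ (d / 2) * Z))).
  rewrite ler_wpM2l ?powR_ge0 //.
  apply: le_trans (sum_gcd_quot_le (f := fun c => c%:R `^ (- 1 - d)) N q0 _) _.
    by move=> c; exact: powR_ge0.
  by rewrite ler_pM ?ler0n ?HD ?sum_powR_le // sumr_ge0 // => *; rewrite powR_ge0.
set u := _ `^ _; set v := _ `^ _.
have -> : u * (D * v * Z) = D * Z * (u * v) by ring.
rewrite ler_wpM2l ?mulr_ge0 // -powRD; last first.
  by rewrite pnatr_eq0 -lt0n q0 implybT.
by rewrite powR_sqr_natr ler_powR ?ler1n //; lra.
Qed.

Lemma powR_div_swap (R : realType) (x y r : R) : 0 < x -> 0 < y ->
  (y / x) `^ r = (x / y) `^ (- r).
Proof.
move=> x0 y0; rewrite -[y / x]invf_div -(@powR_inv1 _ (x / y)) ?divr_ge0 ?ltW //.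
by rewrite -powRrM mulN1r.
Qed.

(** The exponent can be raised above 1 because the floor vanishes when x < m. *)
Lemma natr_le_powR (R : realType) (X m : nat) (x d : R) :
  0 <= d -> 0 <= x -> X%:R <= x -> (0 < m)%N ->
  (X %/ m)%:R <= (x / m%:R) `^ (1 + d).
Proof.
move=> d0 x0 Xx m0; have mR : 0 < m%:R :> R by rewrite ltr0n.
case: (ltnP X m) => [Xm|mX]; first by rewrite divn_small // powR_ge0.
have xm : (X %/ m)%:R <= x / m%:R.
  rewrite ler_pdivlMr // -natrM; apply: le_trans Xx.
  by rewrite ler_nat leq_trunc_div.
apply: (le_trans xm); rewrite -{1}[x / _]powRr1 ?divr_ge0 //.
rewrite ler_powR ?lerDl //; apply: le_trans xm; rewrite ler1n.
by rewrite divn_gt0.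
Qed.

Lemma sum_dvdn_le_size_divisors (m N : nat) : (0 < m)%N ->
  (\sum_(1 <= b < N.+1) (b %| m) <= size (divisors m))%N.
Proof.
move=> m0; rewrite (eq_bigr (fun b => if b %| m then 1 else 0)%N); last first.
  by move=> b _; case: (b %| m)%N.
rewrite -big_mkcond sum1_count -size_filter; apply: uniq_leq_size.
  by rewrite filter_uniq // iota_uniq.
by move=> b; rewrite mem_filter -dvdn_divisors // => /andP[].
Qed.

(** If x < [a^2, b] <= a^2 b, then b^(-beta) <= (a^2/x)^beta. After that b runs
    over divisors of n - h, at most D (2 x)^d in number, and n over multiples of
    a^2, at most (x/a^2)^(1+d) in number. *)
Lemma tail_count_le (R : realType) (beta d D x : R) (h : int) (L X N : nat) :
  0 <= beta -> 0 <= d -> 1 <= x -> `|h|%:~R <= x / 2 -> X%:R <= x ->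
  (h <= L%:Z) ->
  (forall n : nat, (0 < n)%N -> (size (divisors n))%:R <= D * n%:R `^ d) ->
  \sum_(1 <= a < N.+1) \sum_(1 <= b < N.+1) b%:R `^ (- beta) *
    (if x < (lcmn (a ^ 2) b)%:R then (pair_count (a ^ 2) b h L X)%:R else 0)
  <= D * (2 * x) `^ d * \sum_(1 <= a < N.+1) (x / (a ^ 2)%:R) `^ (1 - beta + d).
Proof.
move=> b0 d0 x1 hx Xx hL HD.
have x0 : 0 < x by exact: lt_le_trans ltr01 x1.
have D0 : 0 <= D.
  by have := HD 1%N isT; rewrite powR1 mulr1 => /(le_trans (ler0n _ _)).
rewrite mulr_sumr big_nat [leRHS]big_nat; apply: ler_sum => a /andP[a1 _].
have q0 : (0 < a ^ 2)%N by rewrite expn_gt0 a1.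
move: (a ^ 2)%N q0 => q q0; have qR : 0 < q%:R :> R by rewrite ltr0n.
apply: (@le_trans _ _ (\sum_(1 <= b < N.+1) \sum_(L.+1 <= n < X.+1)
    (q%:R / x) `^ beta * ((q %| n)%N%:R * (b %| `|n%:Z - h|)%N%:R))).
  rewrite big_nat [leRHS]big_nat; apply: ler_sum => b /andP[bgt0 _].
  case: ifP => xl; last first.
    by rewrite mulr0 sumr_ge0 // => n _; rewrite !mulr_ge0 ?powR_ge0.
  rewrite -mulr_sumr /pair_count natr_sum.
  rewrite (eq_bigr (fun n => (q %| n)%N%:R * (b %| `|n%:Z - h|)%N%:R)); last first.
    by move=> n _; rewrite -mulnb natrM.
  rewrite ler_wpM2r //; first by rewrite sumr_ge0 // => n _; rewrite !mulr_ge0.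
  rewrite powR_div_swap //.
  apply: powRN_le => //; first exact: divr_gt0.
  rewrite ler_pdivrMr // mulrC -natrM; apply: le_trans (ltW xl) _; rewrite ler_nat.
  by rewrite dvdn_leq ?muln_gt0 ?q0 // dvdn_lcm dvdn_mulr ?dvdn_mull.
rewrite exchange_big /=.
apply: (@le_trans _ _ (\sum_(L.+1 <= n < X.+1)
    (q%:R / x) `^ beta * (D * (2 * x) `^ d) * (q %| n)%N%:R)).
  rewrite big_nat [leRHS]big_nat; apply: ler_sum => n /andP[Ln nX].
  rewrite -mulr_sumr -mulr_sumr -mulrA ler_wpM2l ?powR_ge0 // mulrC ler_wpM2r //.
  have nh : 0 < n%:Z - h.
    by rewrite subr_gt0; apply: le_lt_trans hL _; rewrite ltz_nat.
  have nh0 : (0 < `|n%:Z - h|)%N by rewrite absz_gt0 gt_eqF.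
  rewrite -natr_sum; apply: (@le_trans _ _ (size (divisors `|n%:Z - h|))%:R).
    by rewrite ler_nat sum_dvdn_le_size_divisors.
  apply: le_trans (HD _ nh0) _; rewrite ler_wpM2l //.
  apply: ge0_ler_powR; rewrite ?nnegrE ?mulr_ge0 ?ler0n ?(ltW x0) //.
  rewrite natr_absz gtr0_norm // intrB.
  have : n%:R <= x by apply: le_trans Xx; rewrite ler_nat -ltnS.
  have : - h%:~R <= `|h|%:~R :> R by rewrite -intrN ler_int -normrN ler_norm.
  rewrite -pmulrn; move: hx; lra.
rewrite -mulr_sumr -natr_sum.
apply: (@le_trans _ _ ((q%:R / x) `^ beta * (D * (2 * x) `^ d) *
    (x / q%:R) `^ (1 + d))).
  rewrite ler_wpM2l ?mulr_ge0 ?powR_ge0 //.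
  apply: le_trans (natr_le_powR d0 (ltW x0) Xx q0); rewrite ler_nat.
  have := sum_dvdn_shift 0 q0 (leq0n X); rewrite div0n addn0 addn0 => <-.
  rewrite (eq_bigr (fun n => (q %| n + 0)%N : nat)); last by move=> n _; rewrite addn0.
  case: (leqP L X) => LX; last by rewrite big_geq // ltnS ltnW.
  by rewrite [leqRHS](@big_cat_nat _ _ _ L.+1) //= leq_addl.
rewrite (powR_div_swap beta x0 qR) [leLHS]mulrAC [leLHS]mulrC.
rewrite ler_wpM2l ?mulr_ge0 ?powR_ge0 //.
rewrite -powRD; last by rewrite (gt_eqF (divr_gt0 x0 qR)) implybT.
by rewrite addrCA addrA.
Qed.

Lemma powR_div (R : realType) (x y r : R) : 0 <= x -> 0 <= y ->
  (x / y) `^ r = x `^ r * y `^ (- r).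
Proof.
move=> x0 y0; rewrite powRM ?invr_ge0 // -(@powR_inv1 _ y) //.
by rewrite -powRrM mulN1r.
Qed.

(** Here y stands for x - H. For moduli m = lcm(q, b) up to x the two errors of
    1, from the count and from replacing X - L by y, are at most (x/m)^s each.
    For m > x the main term is at most x/m <= (x/m)^s, and the count is kept. *)
Lemma count_error_le (R : realType) (x s y : R) (q b : nat) (h : int)
    (L X : nat) :
  (0 < q)%N -> (0 < b)%N -> (L <= X)%N -> 0 < x -> 0 <= s -> s <= 1 ->
  0 <= y -> y <= x -> `|(X - L)%:R - y| <= 1 ->
  `|(pair_count q b h L X)%:R
     - y * (if (gcdn q b %| `|h|)%N then (lcmn q b)%:R^-1 else 0)|
  <= 2 * (x / (lcmn q b)%:R) `^ s
     + (if x < (lcmn q b)%:R then (pair_count q b h L X)%:R else 0).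
Proof.
move=> q0 b0 LX x0 s0 s1 y0 yx Xy.
have mN : (0 < lcmn q b)%N by rewrite lcmn_gt0 q0.
set m : R := (lcmn q b)%:R; have m1 : 1 <= m by rewrite ler1n.
have m0 : 0 < m by exact: lt_le_trans ltr01 m1.
have := pair_count_approx R h q0 b0 LX; rewrite -/m.
set c : R := (pair_count _ _ _ _ _)%:R.
have c0 : 0 <= c by exact: ler0n.
set w := (x / m) `^ s; have w0 : 0 <= w by exact: powR_ge0.
case: (ltP x m) => xm.
  move=> _; have ym : y / m <= w.
    apply: (@le_trans _ _ (x / m)); first by rewrite ler_pM2r ?invr_gt0.
    rewrite /w -{1}[x / m]powRr1 ?divr_ge0 ?(ltW x0) ?(ltW m0) //.
    by apply: ger_powR => //; rewrite divr_gt0 //= ler_pdivrMr // mul1r ltW.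
  have ym0 : 0 <= y / m by rewrite divr_ge0 // ltW.
  case: ifP => _; last first.
    by rewrite mulr0 subr0 ger0_norm // lerDr mulr_ge0.
  by rewrite ler_norml; apply/andP; split; lra.
have w1 : 1 <= w.
  rewrite /w -(powRr0 (x / m)) ler_powR // ler_pdivlMr // mul1r //.
case: ifP => _; last by rewrite mulr0 => h1; apply: (le_trans h1); lra.
move=> h1; have h2 : `|((X - L)%:R - y) / m| <= 1.
  rewrite normrM normfV (gtr0_norm m0) ler_pdivrMr // mul1r.
  exact: le_trans Xy m1.
have -> : c - y * m^-1 = (c - (X - L)%:R / m) + ((X - L)%:R - y) / m by ring.
apply: le_trans (ler_normD _ _) _; lra.
Qed.

(** The condition [d <= beta] makes s = 1 - beta + d at most 1. *)
Lemma weighted_error_le (R : realType) (beta d : R) :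
  0 < beta -> beta <= 2^-1 -> 0 < d -> d <= beta ->
  exists C : R, forall (x y : R) (h : int) (L X N : nat),
    1 <= x -> `|h|%:~R <= x / 2 -> X%:R <= x -> (L <= X)%N -> h <= L%:Z ->
    0 <= y -> y <= x -> `|(X - L)%:R - y| <= 1 ->
  \sum_(1 <= a < N.+1) \sum_(1 <= b < N.+1) b%:R `^ (- beta) *
    `|(pair_count (a ^ 2) b h L X)%:R
     - y * (if (gcdn (a ^ 2) b %| `|h|)%N then (lcmn (a ^ 2) b)%:R^-1 else 0)|
  <= C * x `^ (1 - beta + d *+ 2).
Proof.
move=> b0 b2 d0 db; have [S HS] := sum_pair_weight_le (ltW b0) b2 d0.
have [D HD] := divisor_bound d0; pose Z := 1 + d^-1.
have D0 : 0 <= D.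
  by have := HD 1%N isT; rewrite powR1 mulr1 => /(le_trans (ler0n _ _)).
pose s := 1 - beta + d.
exists (2 * S + D * 2 `^ d * Z) => x y h L X N x1 hx Xx LX hL y0 yx Xy.
have x0 : 0 < x by exact: lt_le_trans ltr01 x1.
have S0 : 0 <= S by have := HS 0%N; rewrite big_geq.
apply: (@le_trans _ _ (\sum_(1 <= a < N.+1) \sum_(1 <= b < N.+1)
  (2 * x `^ s * pair_weight beta s a b + b%:R `^ (- beta) *
    (if x < (lcmn (a ^ 2) b)%:R then (pair_count (a ^ 2) b h L X)%:R else 0)))).
  rewrite big_nat [leRHS]big_nat; apply: ler_sum => a /andP[a1 _].
  have q0 : (0 < a ^ 2)%N by rewrite expn_gt0 a1.
  rewrite big_nat [leRHS]big_nat; apply: ler_sum => b /andP[b1 _].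
  have -> : 2 * x `^ s * pair_weight beta s a b =
      b%:R `^ (- beta) * (2 * (x / (lcmn (a ^ 2) b)%:R) `^ s).
    by rewrite powR_div ?ler0n ?(ltW x0) // /pair_weight; ring.
  rewrite -mulrDr ler_wpM2l ?powR_ge0 //.
  by apply: count_error_le => //; rewrite /s; lra.
under eq_bigr do rewrite big_split /= -mulr_sumr.
rewrite big_split /= -mulr_sumr [leRHS]mulrDl; apply: lerD.
  rewrite mulrAC; apply: ler_pM => //.
  - rewrite mulr_ge0 // sumr_ge0 // => a _; rewrite sumr_ge0 // => b _.
    by rewrite mulr_ge0 // powR_ge0.
  - exact: powR_ge0.
  - by rewrite ler_pM2l.
  - by rewrite ler_powR // /s mulr2n; lra.
apply: le_trans (tail_count_le N (ltW b0) (ltW d0) x1 hx Xx hL HD) _.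
rewrite (eq_bigr (fun a => x `^ s * (a ^ 2)%:R `^ (- s))); last first.
  by move=> a _; rewrite powR_div ?ler0n ?(ltW x0).
rewrite -mulr_sumr powRM ?ler0n ?(ltW x0) //.
have -> : x `^ (1 - beta + d *+ 2) = x `^ d * x `^ s.
  rewrite -powRD; first by congr (_ `^ _); rewrite /s mulr2n; ring.
  by rewrite (gt_eqF x0) implybT.
set t := \sum_(_ <= _ < _) _.
have tZ : t <= Z by exact: sum_sqr_powR_le.
have -> : D * (2 `^ d * x `^ d) * (x `^ s * t) =
  D * 2 `^ d * (x `^ d * x `^ s) * t by ring.
have -> : D * 2 `^ d * Z * (x `^ d * x `^ s) =
  D * 2 `^ d * (x `^ d * x `^ s) * Z by ring.
by rewrite ler_wpM2l // !mulr_ge0 ?powR_ge0.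
Qed.

(** * The expansion over pairs and the series K *)

Lemma sum_divisors_nat (V : zmodType) (F : nat -> V) (m N : nat) :
  (0 < m <= N)%N ->
  \sum_(d <- divisors m) F d = \sum_(1 <= b < N.+1) F b *+ (b %| m)%N.
Proof.
move=> /andP[m0 mN].
rewrite [RHS](eq_bigr (fun b => if (b %| m)%N then F b else 0)); last first.
  by move=> b _; case: (b %| m)%N.
rewrite -big_mkcond -[RHS]big_filter; apply: perm_big; apply: uniq_perm.
- exact: divisors_uniq.
- by rewrite filter_uniq // iota_uniq.
move=> b; rewrite mem_filter -dvdn_divisors // mem_index_iota andb_idr // => bm.
by rewrite ltnS (dvdn_gt0 m0 bm) (leq_trans (dvdn_leq m0 bm)).
Qed.

(** The terms with n <= L vanish since then n - h <= 0; for the others both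
    factors are expanded, and N bounds every a with a^2 | n and every divisor of
    n - h. *)
Lemma sum_sqfree_divisor_sum (R : realType) (g : nat -> R[i]) (h : int)
    (L X N : nat) :
  (L <= X <= N)%N -> h <= L%:Z ->
  (forall n : nat, (n <= L)%N -> (0 < n)%N -> n%:Z - h <= 0) ->
  (forall n : nat, (n <= X)%N -> (`|n%:Z - h| <= N)%N) ->
  \sum_(1 <= n < X.+1) (mobius n ^+ 2)%:~R * divisor_sum g (n%:Z - h)
  = \sum_(1 <= a < N.+1) \sum_(1 <= b < N.+1)
      (mobius a)%:~R * g b * (pair_count (a ^ 2) b h L X)%:R.
Proof.
move=> /andP[LX XN] hL Ln Xn; rewrite (@big_cat_nat _ _ _ L.+1) //=.
rewrite big_nat big1 ?add0r; last first.
  by move=> n /andP[n0 nL]; rewrite /divisor_sum ltNge Ln ?mulr0.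
transitivity (\sum_(L.+1 <= n < X.+1) \sum_(1 <= a < N.+1) \sum_(1 <= b < N.+1)
    (mobius a)%:~R * g b * ((a ^ 2 %| n) && (b %| `|n%:Z - h|))%N%:R).
  rewrite big_nat [RHS]big_nat; apply: eq_bigr => n /andP[nL nX].
  have n0 : (0 < n)%N by exact: leq_ltn_trans nL.
  have nh : 0 < n%:Z - h.
    by rewrite subr_gt0; apply: le_lt_trans hL _; rewrite ltz_nat.
  rewrite /divisor_sum nh (@sum_divisors_nat _ g _ N); last first.
    by rewrite absz_gt0 gt_eqF //= Xn.
  rewrite -(@sum_mobius_sqr_dvdn n N) ?n0 ?(leq_trans _ XN) // big_mkcond /=.
  rewrite rmorph_sum /= mulr_suml; apply: eq_bigr => a _.
  rewrite mulr_sumr; apply: eq_bigr => b _.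
  case: (_ %| n)%N => /=; last by rewrite mul0r mulr0.
  by rewrite -[g b *+ _]mulr_natr mulrA.
rewrite exchange_big /=; apply: eq_bigr => a _; rewrite exchange_big /=.
by apply: eq_bigr => b _; rewrite -mulr_sumr /pair_count natr_sum.
Qed.

Definition index_box (N : nat) : {fset nat * nat} :=
  [fset p in [seq (a, b) | a <- iota 0 N.+1, b <- iota 0 N.+1]]%fset.

Lemma mem_index_box (N : nat) (p : nat * nat) :
  (p \in index_box N) = (p.1 <= N)%N && (p.2 <= N)%N.
Proof.
have -> : (p \in index_box N) =
    (p \in [seq (a, b) | a <- iota 0 N.+1, b <- iota 0 N.+1]).
  by rewrite /index_box; move: [seq _ | _ <- _, _ <- _] => s; rewrite inE.
apply/allpairsP/andP => [[[a b] [ha hb ->]]|[p1 p2]].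
  by move: ha hb; rewrite !mem_iota /= !add0n !ltnS.
case: p p1 p2 => a b p1 p2; exists (a, b).
by split; rewrite ?mem_iota ?add0n ?ltnS.
Qed.

Lemma sum_index_box (V : zmodType) (F : nat * nat -> V) (N : nat) :
  (forall b, F (0, b)%N = 0) -> (forall a, F (a, 0)%N = 0) ->
  \sum_(p <- index_box N) F p =
  \sum_(1 <= a < N.+1) \sum_(1 <= b < N.+1) F (a, b).
Proof.
move=> F0l F0r.
transitivity
  (\sum_(p <- [seq (a, b) | a <- iota 0 N.+1, b <- iota 0 N.+1]) F p).
  apply: perm_big; apply: uniq_perm; first exact: fset_uniq.
    by rewrite allpairs_uniq ?iota_uniq // => -[a b] [c d] _ _.
  move=> p; rewrite mem_index_box.
  apply/andP/allpairsP => [[p1 p2]|[[a b] [ha hb ->]]].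
    case: p p1 p2 => a b p1 p2; exists (a, b).
    by split; rewrite ?mem_iota ?add0n ?ltnS.
  by move: ha hb; rewrite !mem_iota /= !add0n !ltnS.
rewrite big_allpairs -[iota 0 _]/(index_iota 0 N.+1) big_ltn //.
have -> : \sum_(b <- index_iota 0 N.+1) F (0%N, b) = 0 by apply: big1 => b _.
by rewrite /= add0r; apply: eq_bigr => a _; rewrite big_ltn //= F0r add0r.
Qed.

Lemma fset_sub_index_box (J : {fset nat * nat}) (N0 : nat) :
  exists2 N, (N0 <= N)%N & (J `<=` index_box N)%fset.
Proof.
exists (maxn N0 (\max_(p <- J) maxn p.1 p.2)); first exact: leq_maxl.
apply/fsubsetP => p pJ; have : (maxn p.1 p.2 <= \max_(p <- J) maxn p.1 p.2)%N.
  by rewrite (big_rem p) //= leq_maxl.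
set M := \big[_/_]_(_ <- _) _; rewrite geq_max => /andP[p1M p2M].
by rewrite mem_index_box !(leq_trans _ (leq_maxr N0 M)).
Qed.

Lemma norm_complexE (R : realType) (z : R[i]) : `|z| = (complex.Re `|z|)%:C.
Proof. by case: z => a b; rewrite normc_def. Qed.

Lemma normC_real (R : realType) (r : R) : `|r%:C| = `|r|%:C :> R[i].
Proof. by rewrite normc_def /= expr0n addr0 sqrtr_sqr. Qed.

Lemma norm_mobius_le1 (R : realType) (a : nat) : `|(mobius a)%:~R| <= 1 :> R[i].
Proof.
rewrite /mobius; case: ifP => _; last by rewrite normr0.
by rewrite rmorphXn /= rmorphN1 normrX normrN1 expr1n.
Qed.

Lemma norm_Kterm_le (R : realType) (g : nat -> R[i]) (A beta s : R) (h : int)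
    (a b : nat) :
  s <= 1 -> (forall n, (0 < n)%N -> `|g n| <= (A * n%:R `^ (- beta))%:C) ->
  0 <= A ->
  `|Kterm g h (a, b)| <=
  (A * (if (0 < a)%N && (0 < b)%N then pair_weight beta s a b else 0))%:C.
Proof.
move=> s1 gA A0; rewrite /Kterm.
case: ifP => [/and3P[a0 b0 _]|_]; last first.
  rewrite normr0 lecR; case: ifP => _; rewrite ?mulr0 // mulr_ge0 //.
  by rewrite /pair_weight mulr_ge0 // powR_ge0.
have q0 : (0 < lcmn (a ^ 2) b)%N by rewrite lcmn_gt0 expn_gt0 a0.
rewrite a0 b0 /= /pair_weight mulrA normrM normrM rmorphM /=; apply: ler_pM => //.
  rewrite -[leRHS]mul1r; apply: ler_pM => //; [exact: norm_mobius_le1|exact: gA].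
have -> : (lcmn (a ^ 2) b)%:R^-1 = ((lcmn (a ^ 2) b)%:R^-1)%:C :> R[i].
  by rewrite fmorphV /= rmorph_nat.
rewrite normC_real lecR ger0_norm ?invr_ge0 ?ler0n // -(@powR_inv1 _ _%:R) ?ler0n //.
by rewrite ler_powR ?ler1n // lerN2.
Qed.

Lemma Kconverges_of_decay (R : realType) (g : nat -> R[i]) (A beta : R)
    (h : int) :
  0 < beta -> beta <= 2^-1 -> 0 <= A ->
  (forall n, (0 < n)%N -> `|g n| <= (A * n%:R `^ (- beta))%:C) ->
  Kconverges g h.
Proof.
move=> b0 b2 A0 gA; have d0 : 0 < beta / 2 by rewrite divr_gt0.
have [S HS] := sum_pair_weight_le (ltW b0) b2 d0.
apply: (@bounded_complex_series_cvg R _ (Kterm g h) (A * S)) => J.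
pose w (p : nat * nat) : R := if (0 < p.1)%N && (0 < p.2)%N
  then pair_weight beta (1 - beta + beta / 2) p.1 p.2 else 0.
have w0 p : 0 <= w p.
  by rewrite /w; case: ifP => // _; rewrite mulr_ge0 // powR_ge0.
apply: (@le_trans _ _ (\sum_(p <- J) (A * w p)%:C)).
  apply: ler_sum => -[a b] _; apply: norm_Kterm_le => //; lra.
rewrite -rmorph_sum lecR -mulr_sumr ler_wpM2l //.
have [N _ JN] := fset_sub_index_box J 0.
apply: le_trans (ler_sum_fsubset w0 JN) _; rewrite sum_index_box; last 2 first.
- by [].
- by move=> a; rewrite /w andbF.
apply: le_trans (HS N).
rewrite big_nat [leRHS]big_nat; apply: ler_sum => a /andP[a1 _].
rewrite big_nat [leRHS]big_nat; apply: ler_sum => b /andP[b1 _].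
by rewrite /w /= a1 b1.
Qed.

(** Boxes are cofinal among the finite sets of pairs. *)
Lemma Kconverges_box (R : realType) (g : nat -> R[i]) (h : int) (e : R)
    (N0 : nat) :
  Kconverges g h -> 0 < e -> exists2 N, (N0 <= N)%N &
  `|K g h - \sum_(1 <= a < N.+1) \sum_(1 <= b < N.+1) Kterm g h (a, b)|
    < e%:C.
Proof.
move=> gK e0; have FF := @summability.totally_filter (nat * nat)%type.
have : (summability.partial_sum (Kterm g h : _ -> R[i]^o)
    @ summability.totally --> (K g h : R[i]^o))%classic by exact: gK.
move=> /(@cvgrPdist_lt R[i] R[i]^o) /(_ e%:C) [].
  by rewrite ltcR.
move=> J0 _ HJ; have [N N0N J0N] := fset_sub_index_box J0 N0.
exists N => //; have := HJ _ J0N.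
rewrite /= /summability.partial_sum -(big_seq_fsetE _ (index_box N) xpredT) /=.
by rewrite sum_index_box // => a; rewrite /Kterm andbF.
Qed.

(** * The asymptotic formula *)

(** The terms with n <= L = max(h, 0) vanish. For h <= 0 this L differs from
    H = 1, but X - L and x - H still differ by at most 1. *)
Lemma Hshift_bounds (R : realType) (x : R) (h : int) (X := Num.truncn x) :
  1 <= x -> `|h|%:~R <= x / 2 ->
  exists L : nat, [/\ (L <= X)%N, h <= L%:Z,
    forall n : nat, (n <= L)%N -> (0 < n)%N -> n%:Z - h <= 0 &
    [/\ 0 <= x - (Hshift h)%:~R, x - (Hshift h)%:~R <= x &
     `|(X - L)%:R - (x - (Hshift h)%:~R)| <= 1]].
Proof.
move=> x1 hx; have x0 : 0 <= x by exact: le_trans ler01 x1.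
have Xx : X%:R <= x by rewrite truncn_le.
have xX : x < X%:R + 1 by rewrite natr1 truncnS_gt.
rewrite /Hshift; case: ifP => h0.
  exists 0%N; split=> //; first by case.
  rewrite subn0 /=; split; [lra|lra|].
  by rewrite ler_norml; apply/andP; split; lra.
have hgt0 : 0 < h by rewrite ltNge h0.
have hE : h = `|h|%N%:Z by rewrite gtz0_abs.
have hR : h%:~R = `|h|%N%:R :> R by rewrite {1}hE.
move: hx; rewrite gtr0_norm // hR => hx.
have LX : (`|h| <= X)%N.
  by rewrite -ltnS -(ltr_nat R) -natr1; lra.
exists `|h|%N; split=> //.
- by rewrite -hE.
- by move=> n nh _; rewrite subr_le0 hE lez_nat.
have L0 := ler0n R `|h|; rewrite natrB //.
split; [lra|lra|].
by rewrite ler_norml; apply/andP; split; lra.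
Qed.

Lemma sum_sqfree_sub_box_le (R : realType) (g : nat -> R[i]) (A beta y : R)
    (h : int) (L X N : nat) :
  (forall n, (0 < n)%N -> `|g n| <= (A * n%:R `^ (- beta))%:C) ->
  `| \sum_(1 <= a < N.+1) \sum_(1 <= b < N.+1)
      (mobius a)%:~R * g b * (pair_count (a ^ 2) b h L X)%:R
    - y%:C * \sum_(1 <= a < N.+1) \sum_(1 <= b < N.+1) Kterm g h (a, b)|
  <= (A * \sum_(1 <= a < N.+1) \sum_(1 <= b < N.+1) b%:R `^ (- beta) *
    `|(pair_count (a ^ 2) b h L X)%:R
     - y * (if (gcdn (a ^ 2) b %| `|h|)%N then (lcmn (a ^ 2) b)%:R^-1 else 0)|)%:C.
Proof.
move=> gA; rewrite mulr_sumr -sumrB mulr_sumr rmorph_sum /=.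
apply: le_trans (ler_norm_sum _ _ _) _.
rewrite [leLHS]big_nat [leRHS]big_nat; apply: ler_sum => a /andP[a0 _].
rewrite mulr_sumr -sumrB mulr_sumr rmorph_sum /=.
apply: le_trans (ler_norm_sum _ _ _) _.
rewrite [leLHS]big_nat [leRHS]big_nat; apply: ler_sum => b /andP[b0 _].
set c := pair_count _ _ _ _ _.
have -> : (mobius a)%:~R * g b * c%:R - y%:C * Kterm g h (a, b) =
  (mobius a)%:~R * g b * (c%:R - y *
    (if (gcdn (a ^ 2) b %| `|h|)%N then (lcmn (a ^ 2) b)%:R^-1 else 0))%:C.
  rewrite /Kterm a0 b0 /= rmorphB rmorphM /= rmorph_nat mulrBr; congr (_ - _).
  case: ifP => _; last by rewrite rmorph0 !mulr0.
  by rewrite fmorphV /= rmorph_nat mulrCA.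
rewrite [A * (_ * _)]mulrA rmorphM /= normrM normC_real.
rewrite ler_wpM2r ?(lecR 0) // normrM -[leRHS]mul1r.
apply: ler_pM => //.
- exact: norm_mobius_le1.
- exact: gA.
Qed.

Theorem theorem2p5 (R : realType) (alpha eps A : R)
    (alpha_gt0 : 0 < alpha) (eps_gt0 : 0 < eps) :
  exists C : R, forall g : nat -> R[i],
    (forall n : nat, (0 < n)%N -> `|g n| <= (A * n%:R `^ (- alpha))%:C) ->
    (forall h : int, Kconverges g h) /\
    (forall (x : R) (h : int), 1 <= x -> `|h|%:~R <= x / 2 ->
      `| \sum_(1 <= n < (Num.truncn x).+1)
           (mobius n ^+ 2)%:~R * divisor_sum g (n%:Z - h)
         - (x - (Hshift h)%:~R)%:C * K g h |
      <= (C * (x `^ eps * E1 x alpha))%:C).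
Proof.
pose beta := Num.min alpha 2^-1.
have beta0 : 0 < beta by rewrite lt_min alpha_gt0 /= invr_gt0.
have beta2 : beta <= 2^-1 by rewrite ge_min lexx orbT.
have beta_alpha : beta <= alpha by rewrite ge_min lexx.
pose d := Num.min eps beta / 2.
have d0 : 0 < d by rewrite divr_gt0 // lt_min eps_gt0.
have d_beta : d <= beta.
  by rewrite ler_pdivrMr // ge_min; apply/orP; right; lra.
have d_eps : d *+ 2 <= eps.
  by rewrite -mulr_natr divfK ?pnatr_eq0 // ge_min lexx.
have [C HC] := weighted_error_le beta0 beta2 d0 d_beta.
exists (A * C) => g gA.
have A0 : 0 <= A.
  have := gA 1%N isT; rewrite powR1 mulr1 => /(le_trans (normr_ge0 _)).
  by rewrite lecR.
have gA' n : (0 < n)%N -> `|g n| <= (A * n%:R `^ (- beta))%:C.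
  move=> n0; apply: le_trans (gA n n0) _; rewrite lecR ler_wpM2l //.
  by rewrite ler_powR ?ler1n // lerN2.
have gK h : Kconverges g h by exact: Kconverges_of_decay beta0 beta2 A0 gA'.
split=> // x h x1 hx; have x0 : 0 < x by exact: lt_le_trans ltr01 x1.
have [L [LX hL Ln [y0 yx Xy]]] := Hshift_bounds x1 hx.
set X := Num.truncn x in LX Xy *; set y := x - _ in y0 yx Xy *.
have Xx : X%:R <= x by rewrite truncn_le // ltW.
have E1E : x `^ (1 - beta + d *+ 2) <= x `^ eps * E1 x alpha.
  have -> : E1 x alpha = x `^ (1 - beta).
    rewrite /E1 /beta minElt; case: ltgtP => // h2; last by rewrite h2.
    by congr (_ `^ _); lra.
  rewrite -powRD; last by rewrite (gt_eqF x0) implybT.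
  by rewrite ler_powR // addrC lerD2r.
have C0 : 0 <= C.
  have := HC x y h L X 0%N x1 hx Xx LX hL y0 yx Xy.
  by rewrite big_geq // pmulr_lge0 // powR_gt0.
set B := \sum_(_ <= _ < _) _.
suff H : `|B - y%:C * K g h| <= (A * (C * x `^ (1 - beta + d *+ 2)))%:C.
  apply: le_trans H _; rewrite lecR -mulrA ler_wpM2l // ler_wpM2l //.
rewrite norm_complexE lecR; apply/ler_addgt0Pr => e e0.
(* The error in K is multiplied by y = x - H, which may vanish. *)
have e'0 : 0 < e / (y + 1) by rewrite divr_gt0 // ltr_wpDl.
have [N N0 HN] := Kconverges_box (X + `|h|) (gK h) e'0.
have LXN : (L <= X <= N)%N by rewrite LX (leq_trans (leq_addr _ _) N0).
have Xn n : (n <= X)%N -> (`|n%:Z - h| <= N)%N by move: N0; clear; lia.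
have BE := sum_sqfree_divisor_sum g LXN hL Ln Xn.
rewrite -lecR -norm_complexE.
set T := \sum_(_ <= _ < _) _ in HN.
have -> : B - y%:C * K g h = (B - y%:C * T) - y%:C * (K g h - T) by ring.
apply: le_trans (ler_normB _ _) _; rewrite [leRHS]rmorphD /=; apply: lerD.
  rewrite /B BE; apply: le_trans (sum_sqfree_sub_box_le _ _ _ _ _ gA') _.
  by rewrite lecR ler_wpM2l // HC.
rewrite normrM normC_real (ger0_norm y0).
have yC : 0 <= y%:C :> R[i] by rewrite (lecR 0).
apply: le_trans (ler_wpM2l yC (ltW HN)) _.
rewrite -rmorphM lecR mulrCA ler_piMr ?(ltW e0) // ler_pdivrMr ?ltr_wpDl //.
by rewrite mul1r lerDl.
Qed.
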